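(* Let $R$ be a ring that is not artinian semisimple. Then there is no pair consisting of an abelian category $\mathcal{A}$ and an additive functor $F\colon \mathrm{Mod}\text{-}R\to\mathcal{A}$ with the following property: for every cochain complex $A_R \xrightarrow{f} B_R \xrightarrow{g} C_R$ of right $R$-modules (i.e. $gf=0$), the complex $A_R \xrightarrow{f} B_R \xrightarrow{g} C_R$ is $e$-exact if and only if the cochain complex $F(A_R) \xrightarrow{F(f)} F(B_R) \xrightarrow{F(g)} F(C_R)$ is exact in $\mathcal{A}$.
   Context: Rings are associative with identity $1\neq 0$, not necessarily commutative; modules are unitary right modules; $\mathrm{Mod}\text{-}R$ is the category of right $R$-modules. A submodule $N\le M$ is essential in $M$ if $N\cap X\neq 0$ for every nonzero submodule $X$ of $M$. A cochain complex of right $R$-modules $A_R \xrightarrow{f} B_R \xrightarrow{g} C_R$ (so $gf=0$) is called $e$-exact if $f(A_R)$ is an essential submodule of $\ker(g)$. A ring $R$ is artinian semisimple if $R_R$ is a semisimple module. *)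

(* Defs.v *)
From HB Require Import structures.
From mathcomp Require Import all_boot all_algebra.
From mathcomp Require Import boolp classical_sets.

Set Implicit Arguments.
Unset Strict Implicit.
Unset Printing Implicit Defensive.
Import GRing.Theory.
Local Open Scope classical_set_scope.
Local Open Scope ring_scope.

(* A right R-module is an [lmodType R^c], where [R^c] is the converse ring:
   the right action m a is written [a *: m].  The [choiceType] part of the
   bundle is no restriction, by [gen_eqMixin] and [gen_choiceMixin]. *)
Notation rmodType R := (lmodType R^c).

Section Modules.
Variable R : nzRingType.
Implicit Types M : rmodType R.

Definition submodule M (N : set M) : Prop := submod_closed (mem N).

Definition essential_in M (N P : set M) : Prop :=
  [/\ submodule N, submodule P, N `<=` P &
      forall X : set M, submodule X -> X `<=` P -> X <> [set 0] ->
        N `&` X <> [set 0]].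

Definition simple_submodule M (S : set M) : Prop :=
  [/\ submodule S, S <> [set 0] &
      forall X : set M, submodule X -> X `<=` S -> X = [set 0] \/ X = S].

Definition internal_direct_sum M (I : eqType) (S : I -> set M) : Prop :=
  (forall m : M, exists (s : seq I) (x : I -> M),
     [/\ uniq s, forall i, S i (x i) & m = \sum_(i <- s) x i]) /\
  (forall (s : seq I) (x : I -> M), uniq s -> (forall i, S i (x i)) ->
     \sum_(i <- s) x i = 0 -> forall i, i \in s -> x i = 0).

Definition semisimple_module M : Prop :=
  exists (I : eqType) (S : I -> set M),
    (forall i, simple_submodule (S i)) /\ internal_direct_sum S.

End Modules.

(* [R^c^o] is R_R: for a : R^c and x : R^c^o, [a *: x] is the product x a of R. *)
Definition artinian_semisimple (R : nzRingType) : Prop :=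
  @semisimple_module R (R^c^o).

Record preadditive := Preadditive {
  obj :> Type;
  mor : obj -> obj -> zmodType;
  idm : forall X, mor X X;
  compm : forall X Y Z, mor Y Z -> mor X Y -> mor X Z;
  comp1m : forall X Y (f : mor X Y), compm (idm Y) f = f;
  compm1 : forall X Y (f : mor X Y), compm f (idm X) = f;
  compA : forall X Y Z T (h : mor Z T) (g : mor Y Z) (f : mor X Y),
    compm h (compm g f) = compm (compm h g) f;
  compDl : forall X Y Z (g g' : mor Y Z) (f : mor X Y),
    compm (g + g') f = compm g f + compm g' f;
  compDr : forall X Y Z (g : mor Y Z) (f f' : mor X Y),
    compm g (f + f') = compm g f + compm g f'
}.
Arguments mor {p} X Y.
Arguments idm {p} X.
Arguments compm {p X Y Z} g f.

Section Abelian.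
Variable C : preadditive.
Implicit Types X Y Z T K Q : C.

Definition is_zero_object Z : Prop :=
  forall X, (exists! f : mor X Z, True) /\ (exists! f : mor Z X, True).

Definition is_product X Y P (p : mor P X) (q : mor P Y) : Prop :=
  forall T (f : mor T X) (g : mor T Y),
    exists! u : mor T P, compm p u = f /\ compm q u = g.

Definition is_kernel X Y K (f : mor X Y) (k : mor K X) : Prop :=
  compm f k = 0 /\
  forall T (t : mor T X), compm f t = 0 -> exists! u : mor T K, compm k u = t.

Definition is_cokernel X Y Q (f : mor X Y) (q : mor Y Q) : Prop :=
  compm q f = 0 /\
  forall T (t : mor Y T), compm t f = 0 -> exists! u : mor Q T, compm u q = t.

Definition is_mono X Y (f : mor X Y) : Prop :=
  forall T (u v : mor T X), compm f u = compm f v -> u = v.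

Definition is_epi X Y (f : mor X Y) : Prop :=
  forall T (u v : mor Y T), compm u f = compm v f -> u = v.

Definition is_abelian : Prop :=
  (exists Z, is_zero_object Z) /\
  (forall X Y, exists P (p : mor P X) (q : mor P Y), is_product p q) /\
  (forall X Y (f : mor X Y), exists K (k : mor K X), is_kernel f k) /\
  (forall X Y (f : mor X Y), exists Q (q : mor Y Q), is_cokernel f q) /\
  (forall X Y (f : mor X Y), is_mono f -> exists Z (g : mor Y Z), is_kernel g f) /\
  (forall X Y (f : mor X Y), is_epi f -> exists Z (g : mor Z X), is_cokernel g f).

Definition is_image X Y K (f : mor X Y) (k : mor K Y) : Prop :=
  exists Q (q : mor Y Q), is_cokernel f q /\ is_kernel q k.

Definition exact_at X Y Z (f : mor X Y) (g : mor Y Z) : Prop :=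
  compm g f = 0 /\ exists K (k : mor K Y), is_image f k /\ is_kernel g k.

End Abelian.

Record additive_functor (C D : preadditive) := AdditiveFunctor {
  fobj :> C -> D;
  fmap : forall X Y : C, mor X Y -> mor (fobj X) (fobj Y);
  fmap1 : forall X : C, fmap (idm X) = idm (fobj X);
  fmapM : forall (X Y Z : C) (g : mor Y Z) (f : mor X Y),
    fmap (compm g f) = compm (fmap g) (fmap f);
  fmapD : forall (X Y : C) (f g : mor X Y), fmap (f + g) = fmap f + fmap g
}.
Arguments fmap {C D} a {X Y} f.

Section ModR.
Variable R : nzRingType.

Definition rhom (A B : rmodType R) : Type := {linear A -> B}.

HB.instance Definition _ A B := gen_eqMixin (rhom A B).
HB.instance Definition _ A B := gen_choiceMixin (rhom A B).

Definition rhom_fun A B (f : rhom A B) : {linear A -> B} := f.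
Coercion rhom_fun : rhom >-> GRing.Linear.type.

Lemma rhomP A B (f g : rhom A B) : (f : A -> B) =1 g -> f = g.
Proof.
move: f g => [f cf] [g cg] /= /funext fg; case: _ / fg in cg *.
move: cf cg => [[f0] [fZ]] [[g0] [gZ]].
by rewrite (Prop_irrelevance f0 g0) (Prop_irrelevance fZ gZ).
Qed.

Definition rhom0 A B : rhom A B := GRing.Linear.clone _ _ _ _ (\0 : A -> B) _.
Definition rhomN A B (f : rhom A B) : rhom A B :=
  GRing.Linear.clone _ _ _ _ (\- (f : A -> B)) _.
Definition rhomD A B (f g : rhom A B) : rhom A B :=
  GRing.Linear.clone _ _ _ _ ((f : A -> B) \+ g) _.
Definition rhom1 A : rhom A A := GRing.Linear.clone _ _ _ _ (@idfun A) _.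
Definition rhomM A B C (g : rhom B C) (f : rhom A B) : rhom A C :=
  GRing.Linear.clone _ _ _ _ ((g : B -> C) \o f) _.

Lemma rhomDA A B : associative (@rhomD A B).
Proof. by move=> f g h; apply: rhomP => x /=; rewrite addrA. Qed.
Lemma rhomDC A B : commutative (@rhomD A B).
Proof. by move=> f g; apply: rhomP => x /=; rewrite addrC. Qed.
Lemma rhom0D A B : left_id (@rhom0 A B) (@rhomD A B).
Proof. by move=> f; apply: rhomP => x /=; rewrite add0r. Qed.
Lemma rhomND A B : left_inverse (@rhom0 A B) (@rhomN A B) (@rhomD A B).
Proof. by move=> f; apply: rhomP => x /=; rewrite addNr. Qed.

HB.instance Definition _ A B := GRing.isZmodule.Build (rhom A B)
  (@rhomDA A B) (@rhomDC A B) (@rhom0D A B) (@rhomND A B).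

Definition ModR : preadditive.
Proof.
refine (@Preadditive (rmodType R) (fun A B => rhom A B : zmodType)
          rhom1 rhomM _ _ _ _ _).
- by move=> A B f; apply: rhomP.
- by move=> A B f; apply: rhomP.
- by move=> A B C D h g f; apply: rhomP.
- by move=> A B C g g' f; apply: rhomP.
- by move=> A B C g f f'; apply: rhomP => x /=; rewrite linearD.
Defined.

Definition e_exact (A B C : rmodType R) (f : rhom A B) (g : rhom B C) : Prop :=
  essential_in (range (f : A -> B)) [set b | g b = 0].

End ModR.

(* Main.v *)
(* A ring that is not semisimple has a proper essential right ideal D: take a
   maximal independent family of simple right ideals, with sum T <> R, and a
   right ideal D containing T and maximal among those avoiding 1.  A nonzero
   right ideal X with X :&: D = 0 would be a complement of the maximal right
   ideal D, hence simple and independent of the family.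
   Let i : D -> R and p : R -> R/D be the canonical maps.  As D is essential,
   F i is an epimorphism; as p i = 0, F p = 0 = F 0.  Exactness of
   F R -> F (R/D) -> 0 thus cannot depend on whether the first arrow comes from
   p or from 0, whereas e-exactness does, since R/D <> 0. *)

From HB Require Import structures.
Require Import Defs.
From mathcomp Require Import all_boot all_algebra.
From mathcomp Require Import boolp classical_sets.
Set Implicit Arguments.
Unset Strict Implicit.
Unset Printing Implicit Defensive.
Import GRing.Theory.
Local Open Scope classical_set_scope.
Local Open Scope quotient_scope.
Local Open Scope ring_scope.

(** * Submodules and quotients as right modules *)

Section SubAndQuotientModules.
Variables (R : nzRingType) (M : rmodType R) (N : set M) (subN : submodule N).

(** The proof of [submodule N] is kept as an argument so that the closure instance below can be
    inferred from the predicate alone. *)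
Definition submodule_pred of submodule N : {pred M} := mem N.
Local Notation D := (submodule_pred subN).

Lemma submodule_pred_closed : GRing.subsemimod_closed D.
Proof. exact: (GRing.submod_closed_semi subN). Qed.

HB.instance Definition _ := GRing.isSubmodClosed.Build _ M D submodule_pred_closed.

Definition submodule_type := {x : M | x \in D}.

HB.instance Definition _ := SubChoice.on submodule_type.
HB.instance Definition _ := [SubChoice_isSubLmodule of submodule_type by <:].

Lemma range_submodule_val : range (\val : submodule_type -> M) = N.
Proof.
apply/seteqP; split=> [_ [u _ <-] | x Nx]; first exact: set_mem (valP u).
by exists (exist _ x (mem_set Nx)).
Qed.

Definition quotient_module := Quotient.quot D.

HB.instance Definition _ := GRing.Zmodule.on quotient_module.

Definition quotient_proj (x : M) : quotient_module := \pi_(Quotient.quot D) x.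

Lemma quotient_projD : {morph quotient_proj : x y / x + y}.
Proof. exact: raddfD. Qed.

Definition quotient_scale (a : R^c) (q : quotient_module) : quotient_module :=
  quotient_proj (a *: repr (q : Quotient.quot D)).

Lemma quotient_projK (q : quotient_module) :
  quotient_proj (repr (q : Quotient.quot D)) = q.
Proof. exact: reprK. Qed.

(** The scaling does not depend on the representative: [x] and the chosen one differ by an element
    of [N], and [N] is stable under [a]. The module axioms then descend from [M]. *)
Lemma quotient_projZ a x :
  quotient_proj (a *: x) = quotient_scale a (quotient_proj x).
Proof.
apply/eqP; rewrite -Quotient.idealrBE -scalerBr rpredZ //.
by rewrite Quotient.idealrBE reprK.
Qed.

Lemma quotient_scaleA a b q :
  quotient_scale a (quotient_scale b q) = quotient_scale (a * b) q.
Proof. by rewrite -[q]quotient_projK -!quotient_projZ scalerA. Qed.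

Lemma quotient_scale1 : left_id 1 quotient_scale.
Proof. by move=> q; rewrite -[q]quotient_projK -quotient_projZ scale1r. Qed.

Lemma quotient_scaleDr : right_distributive quotient_scale +%R.
Proof.
move=> a q r; rewrite -[q]quotient_projK -[r]quotient_projK.
by rewrite -quotient_projD -!quotient_projZ scalerDr quotient_projD.
Qed.

Lemma quotient_scaleDl q : {morph quotient_scale^~ q : a b / a + b}.
Proof.
move=> a b; rewrite -[q]quotient_projK -!quotient_projZ scalerDl.
exact: quotient_projD.
Qed.

HB.instance Definition _ := GRing.Zmodule_isLmodule.Build R^c quotient_module
  quotient_scaleA quotient_scale1 quotient_scaleDr quotient_scaleDl.

Lemma quotient_proj_is_linear : linear quotient_proj.
Proof. by move=> a x y; rewrite quotient_projD quotient_projZ. Qed.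

HB.instance Definition _ :=
  GRing.isLinear.Build R^c M quotient_module _ quotient_proj
    quotient_proj_is_linear.

Lemma quotient_proj_eq0 x : quotient_proj x = 0 <-> N x.
Proof.
have {1}-> : 0 = quotient_proj 0 by rewrite linear0.
split=> [/eqP | Nx]; last apply/eqP; rewrite -Quotient.idealrBE subr0.
- exact: set_mem.
- exact: mem_set.
Qed.

End SubAndQuotientModules.

(** The identity of [Y] factors through the kernel [k] of the zero map. The cokernel [q] of [f]
    kills [k], so [q = 0]; and [h] factors through [q]. *)
Lemma exact_at_to0 (C : preadditive) (X Y Z T : C) (f : mor X Y) (h : mor Y T) :
  exact_at f (0 : mor Y Z) -> compm h f = 0 -> h = 0.
Proof.
move=> [_ [K [k [[Q [q [cokq kerk]]] [_ univ0]]]]] hf.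
have comp0r (A B E : C) (g : mor A B) : compm (0 : mor B E) g = 0.
  by apply: (addrI (compm 0 g)); rewrite -compDl !addr0.
have compr0 (A B E : C) (g : mor B E) : compm g (0 : mor A B) = 0.
  by apply: (addrI (compm g 0)); rewrite -compDr !addr0.
have [u [ku _]] := univ0 _ (idm Y) (comp0r _ _ _ _).
have q0 : q = 0 by rewrite -[q]compm1 -ku Defs.compA kerk.1 comp0r.
by have [v [<- _]] := cokq.2 _ h hf; rewrite q0 compr0.
Qed.

(** * Independent families of submodules and Zorn's lemma *)

Section IndependentFamilies.
Variables (R : nzRingType) (M : rmodType R).
Implicit Types (S T D E X : set M) (F : set (set M)).

Lemma submodule0 T : submodule T -> T 0.
Proof. by case=> /set_mem. Qed.

Lemma submoduleP T : submodule T ->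
  forall (a : R^c) x y, T x -> T y -> T (a *: x + y).
Proof. by case=> _ lT a x y /mem_set Tx /mem_set Ty; apply/set_mem/lT. Qed.

Lemma submoduleI T :
  T 0 -> (forall (a : R^c) x y, T x -> T y -> T (a *: x + y)) -> submodule T.
Proof.
move=> T0 TP; split; first exact: mem_set.
by move=> a x y /set_mem Tx /set_mem Ty; apply/mem_set/TP.
Qed.

Lemma submoduleD T x y : submodule T -> T x -> T y -> T (x + y).
Proof. by move=> sT Tx Ty; rewrite -[x]scale1r; apply: submoduleP. Qed.

Lemma submoduleZ T (a : R^c) x : submodule T -> T x -> T (a *: x).
Proof.
by move=> sT Tx; rewrite -[_ *: _]addr0; apply: submoduleP => //; apply: submodule0.
Qed.

Lemma submoduleN T x : submodule T -> T x -> T (- x).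
Proof. by move=> sT Tx; rewrite -scaleN1r; apply: submoduleZ. Qed.

Lemma submodule_neq0 T : submodule T -> T <> [set 0] -> exists2 x, T x & x <> 0.
Proof.
move=> sT; apply: contra_notP => nT; apply/seteqP; split=> [x Tx | _ ->].
  by apply: contrapT => x0; apply: nT; exists x.
exact: submodule0.
Qed.

Lemma submoduleT : submodule (setT : set M).
Proof. exact: submoduleI. Qed.

Lemma essential_in_refl T : submodule T -> essential_in T T.
Proof. by move=> sT; split=> // X _ /setIidPr ->. Qed.

Lemma exists_maximal_submodule_avoiding T m : submodule T -> ~ T m ->
  exists D, [/\ submodule D, T `<=` D, ~ D m &
    forall E, submodule E -> D `<=` E -> ~ E m -> E = D].
Proof.
move=> sT Tm.
(* Adjoining [T] inside the property makes it hold for the union of the empty chain, where the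
   submodule is [T] itself. *)
pose P := [set X : set M | submodule (T `|` X) /\ ~ (T `|` X) m].
have [F FP Ftot|A [[sA Am] Amax]] := @Zorn_bigcup M P.
  have [F0|nF0] := pselect (F = set0).
    by rewrite F0 bigcup_set0; split; rewrite setU0.
  have [X0 FX0] : F !=set0 by apply/set0P/eqP.
  have common x y : (T `|` \bigcup_(X in F) X) x ->
      (T `|` \bigcup_(X in F) X) y -> exists X, [/\ F X, (T `|` X) x & (T `|` X) y].
    move=> [Tx|[X FX Xx]] [Ty|[Y FY Yy]].
    - by exists X0; split=> //; left.
    - by exists Y; split=> //; [left | right].
    - by exists X; split=> //; [right | left].
    have [XY|YX] := Ftot _ _ FX FY.
      by exists Y; split=> //; right => //; apply: XY.
    by exists X; split=> //; right => //; apply: YX.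
  split=> [|Um].
    apply: submoduleI => [|a x y Ux Uy]; first by left; apply: submodule0.
    have [X [FX Xx Xy]] := common _ _ Ux Uy.
    have [] := submoduleP (FP _ FX).1 a Xx Xy; first by left.
    by move=> ?; right; exists X.
  by have [X [FX Xm _]] := common _ _ Um Um; apply: (FP _ FX).2.
exists (T `|` A); split=> // E sE AE Em; apply: contrapT => neE.
have TE : T `|` E = E by apply/setUidPr => x Tx; apply: AE; left.
apply: (Amax E); last by split; rewrite TE.
split=> [x Ax | EA]; first by apply: AE; right.
by apply: neE; apply/seteqP; split=> // x Ex; right; apply: EA.
Qed.

(** Each submodule serves as its own index; the values of [x] off [s] are unconstrained. *)
Definition family_in F (s : seq (set M)) (x : set M -> M) : Prop :=
  uniq s /\ {in s, forall S, F S /\ S (x S)}.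

Definition independent F : Prop := forall s x,
  family_in F s x -> \sum_(S <- s) x S = 0 -> {in s, forall S, x S = 0}.

Definition sum_of F : set M :=
  [set m | exists s x, family_in F s x /\ m = \sum_(S <- s) x S].

Lemma sum_of_submodule F : (forall S, F S -> submodule S) -> submodule (sum_of F).
Proof.
move=> sF; apply: submoduleI.
  by exists [::], (fun=> 0); rewrite big_nil; split.
move=> a _ _ [s [x [[us sx] ->]]] [t [y [[ut ty] ->]]].
pose r := undup (s ++ t).
(* Both families are extended by 0 to the merged support [r], which keeps their sums. *)
have restrict (q : seq (set M)) (z : set M -> M) : uniq q -> {subset q <= r} ->
    \sum_(S <- r) (if S \in q then z S else 0) = \sum_(S <- q) z S.
  move=> uq qr; rewrite -big_mkcond -big_filter; apply/perm_big/uniq_perm => //.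
    exact/filter_uniq/undup_uniq.
  move=> S; rewrite mem_filter; case qS: (S \in q) => //=; exact: qr.
exists r, (fun S => a *: (if S \in s then x S else 0) +
                    (if S \in t then y S else 0)); split; last first.
  rewrite big_split -scaler_sumr /= !restrict // => S.
    by rewrite mem_undup mem_cat orbC => ->.
  by rewrite mem_undup mem_cat => ->.
split; first exact: undup_uniq.
move=> S; rewrite mem_undup mem_cat => st.
have FS : F S by case/orP: st => [/sx[]|/ty[]].
split=> //; apply: (submoduleP (sF S FS)).
  by case: ifP => [/sx[]//|_]; apply: (submodule0 (sF S FS)).
by case: ifP => [/ty[]//|_]; apply: (submodule0 (sF S FS)).
Qed.

Lemma subset_sum_of F S : F S -> S `<=` sum_of F.
Proof.
move=> FS m Sm; exists [:: S], (fun=> m); rewrite big_seq1; split=> //.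
by split=> // T; rewrite inE => /eqP ->.
Qed.

(** A linear relation involves finitely many submodules, and in a chain these all lie in one
    member. *)
Lemma independent_bigcup (C : set (set (set M))) :
  (forall F, C F -> independent F) -> total_on C subset ->
  independent (\bigcup_(F in C) F).
Proof.
move=> Cind Ctot s x [us sx] s0.
(* The empty relation is set apart because the chain [C] may be empty. *)
have [sE|[F CF sF]] : s = [::] \/ exists2 F, C F & {in s, forall S, F S}.
  elim: s sx {us s0} => [|S s IH] sx; first by left.
  have [[F CF FS] _] := sx S (mem_head _ _).
  right; have [T Ts|s0|[G CG sG]] := IH.
  - by apply: sx; rewrite inE Ts orbT.
  - by exists F => // T; rewrite s0 inE => /eqP ->.
  have [FG|GF] := Ctot _ _ CF CG.
    by exists G => // T; rewrite inE => /orP[/eqP ->|/sG//]; apply: FG.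
  by exists F => // T; rewrite inE => /orP[/eqP ->|/sG /GF].
  by move=> S; rewrite sE.
apply: (Cind F CF) => //; split=> // S Ss.
by split; [apply: sF | case: (sx S Ss)].
Qed.

(** In a relation involving [S], its component is minus a sum of components from [F], hence lies in
    the zero intersection; what remains is a relation within [F]. *)
Lemma independentU1 F S : independent F -> (forall T, F T -> submodule T) ->
  submodule S -> S `&` sum_of F = [set 0] -> independent (F `|` [set S]).
Proof.
move=> Find sF sS SF s x [us sx] s0.
have restF (t : seq (set M)) : {subset t <= s} -> S \notin t ->
    {in t, forall T, F T /\ T (x T)}.
  move=> ts St T Tt; have [[FT|TS] Tx] := sx T (ts _ Tt) => //.
  by rewrite -TS Tt in St.
have [Ss|Ss] := boolP (S \in s); last first.
  by apply: Find => //; split=> //; apply: restF.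
pose t := rem S s.
have St : S \notin t by rewrite mem_rem_uniq // inE eqxx.
have ut : uniq t by apply: rem_uniq.
have Ft : family_in F t x by split=> //; apply: restF => //; apply: mem_rem.
move: s0; rewrite (perm_big _ (perm_to_rem Ss)) big_cons -/t /= => s0.
have xS0 : x S = 0.
  suff : (S `&` sum_of F) (x S) by rewrite SF.
  split; first by case: (sx S Ss).
  move/eqP: s0; rewrite addr_eq0 => /eqP ->.
  by apply: submoduleN; [apply: sum_of_submodule | exists t, x].
move: s0; rewrite xS0 add0r => s0 T.
rewrite (perm_mem (perm_to_rem Ss)) inE => /orP[/eqP -> //|].
exact: Find Ft s0 T.
Qed.

Lemma exists_maximal_independent : exists F,
  [/\ forall S, F S -> simple_submodule S, independent F &
      forall S, simple_submodule S -> S `&` sum_of F <> [set 0]].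
Proof.
pose P := [set F | (forall S, F S -> simple_submodule S) /\ independent F].
have [C CP Ctot|F [[simF indF] Fmax]] := @Zorn_bigcup _ P.
  split=> [S [F CF FS]|]; first exact: (CP F CF).1.
  by apply: independent_bigcup => // F /CP[].
have sF S : F S -> submodule S by case/simF.
exists F; split=> // S simS SF; have [sS nS _] := simS.
apply: (Fmax (F `|` [set S])); last first.
  split; last exact: independentU1.
  by move=> T [/simF|->].
split=> [T FT|FS]; first by left.
(* The enlargement is strict: were [S] in [F], it would lie in [sum_of F] and so be zero. *)
apply: nS; rewrite -SF; apply/esym/setIidPl/subset_sum_of/FS; by right.
Qed.

Lemma semisimple_sum_of F : (forall S, F S -> simple_submodule S) ->
  independent F -> sum_of F = setT -> semisimple_module M.
Proof.
move=> simF indF sumF.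
pose I := {S : set M | S \in F}; exists I, (fun i => val i).
have sF (i : I) : submodule (val i) by case: (simF _ (set_mem (valP i))).
split=> [i|]; first exact/simF/set_mem/valP.
split=> [m|s x us sx s0 i si].
  have [s [x [[us sx] ->]]] : sum_of F m by rewrite sumF.
  (* [internal_direct_sum] constrains the components at every index, hence the value 0 off [s]. *)
  pose y (i : I) := if val i \in s then x (val i) else 0.
  have Fs : all (mem F) s by apply/allP => S Ss; apply/mem_set; case: (sx S Ss).
  exists (pmap insub s), y; split.
  - by apply: (pmap_uniq (@insubK _ _ _)).
  - move=> i; rewrite /y; case: ifP => [/sx[]//|_]; exact: submodule0.
  rewrite -(big_map val predT (fun S => if S \in s then x S else 0)).
  rewrite pmap_filter; last exact: insubK.
  rewrite (eq_filter (a2 := mem F)); last by move=> S; rewrite isSome_insub.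
  by rewrite (all_filterP Fs) -big_mkcond big_seq.
(* Conversely, [x] is extended from the index type to all sets, by 0 outside [F]. *)
pose y S := odflt 0 (omap x (insub S : option I)).
have yE j : y (val j) = x j by rewrite /y valK.
rewrite -yE; apply: (indF (map val s)).
- split; first by rewrite map_inj_uniq //; apply: val_inj.
  by move=> _ /mapP[j _ ->]; split; [apply/set_mem/valP | rewrite yE].
- by rewrite big_map -[RHS]s0; apply: eq_bigr => j _; rewrite yE.
exact: map_f.
Qed.

End IndependentFamilies.

(** * Proper essential right ideals *)

Lemma exists_proper_essential_right_ideal (R : nzRingType) :
  ~ artinian_semisimple R ->
  exists D : set R^c^o, essential_in D setT /\ ~ D 1.
Proof.
move=> nss; have [F [simF indF Fmax]] := exists_maximal_independent (R^c^o : rmodType R).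
have sT : submodule (sum_of F) by apply: sum_of_submodule => S /simF[].
have full (D : set R^c^o) : submodule D -> D 1 -> D = setT.
  move=> sD D1; apply/seteqP; split=> // x _.
  (* The action on [R^c^o] is the product of [R^c], so this reads [x = 1 x] in [R]. *)
  have -> : x = (x : R^c) *: (1 : R^c^o) by exact: esym (mulr1 (x : R^c)).
  exact: submoduleZ.
have T1 : ~ sum_of F 1.
  by move/(full _ sT)/(semisimple_sum_of simF indF).
have [D [sD TD D1 Dmax]] := exists_maximal_submodule_avoiding sT T1.
exists D; split=> //; split=> // [|X sX _ nX DX]; first exact: submoduleT.
have DX0 x : D x -> X x -> x = 0.
  by move=> Dx Xx; suff : (D `&` X) x by rewrite DX.
(* It remains to see that [X] is simple and meets [sum_of F], a part of [D], in zero. *)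
apply: (Fmax X); last first.
  apply/seteqP; split=> [x [Xx /TD Dx]|_ ->]; first exact: DX0.
  by split; apply: submodule0.
split=> // Y sY YX; have [->|nY] := pselect (Y = [set 0]); [by left|right].
have [y Yy y0] := submodule_neq0 sY nY.
(* [E] is [D + Y]. It contains 1, since otherwise maximality gives [E = D], which puts [y] in both
   [D] and [X]. *)
pose E := [set z | exists d v, [/\ D d, Y v & z = d + v]].
have sE : submodule E.
  apply: submoduleI.
    by exists 0, 0; rewrite addr0; split=> //; apply: submodule0.
  move=> a _ _ [d [v [Dd Yv ->]]] [e [w [De Yw ->]]].
  exists (a *: d + e), (a *: v + w); split; [exact: submoduleP..|].
  by rewrite scalerDr addrACA.
have E1 : E 1.
  apply: contrapT => E1; apply: y0; apply: DX0; last exact: YX.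
  rewrite -(Dmax E) // => [|d Dd]; [exists 0, y | exists d, 0].
    by rewrite add0r; split=> //; apply: submodule0.
  by rewrite addr0; split=> //; apply: submodule0.
apply/seteqP; split=> // x Xx.
have [d [v [Dd Yv xE]]] : E x by rewrite (full E).
(* Modular law: [d = x - v] lies in both [D] and [X], so [x = v] is in [Y]. *)
have d0 : d = 0.
  apply: DX0 => //; rewrite -[d](addrK v) -xE.
  by apply: submoduleD => //; apply: submoduleN => //; apply: YX.
by rewrite xE d0 add0r.
Qed.

(** * The functor applied to the quotient by an essential right ideal *)

Theorem theorem3p8 (R : nzRingType) (hR : ~ artinian_semisimple R) :
  ~ exists (A : preadditive) (F : additive_functor (ModR R) A),
      is_abelian A /\
      forall (X Y Z : ModR R) (f : mor X Y) (g : mor Y Z),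
        compm g f = 0 ->
        (e_exact f g <-> exact_at (fmap F f) (fmap F g)).
Proof.
case=> A [F [_ Fexact]].
have [D [essD D1]] := exists_proper_essential_right_ideal hR.
have [sD _ _ _] := essD.
have fmap0 (X Y : ModR R) : fmap F (0 : mor X Y) = 0.
  by apply: (addrI (fmap F 0)); rewrite -fmapD !addr0.
pose RR : ModR R := (R^c^o : rmodType R).
pose I : ModR R := (submodule_type sD : rmodType R).
pose Q : ModR R := (quotient_module sD : rmodType R).
pose i : mor I RR := (\val : {linear submodule_type sD -> R^c^o}).
pose p : mor RR Q := (quotient_proj sD : {linear R^c^o -> quotient_module sD}).
have ker0 (Y Z : rmodType R) : [set y | (0 : rhom Y Z) y = 0] = setT.
  exact/seteqP.
have p_i : compm p i = 0.
  by apply: rhomP => u; apply/quotient_proj_eq0/set_mem/valP.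
have Fp0 : fmap F p = 0.
  apply: (@exact_at_to0 _ _ _ (F RR) _ (fmap F i)).
    (* Writing 0 as the image under [F] of the zero map of [R] turns the goal into e-exactness of
       [D -> R -0-> R], which is essentiality of [D]. *)
    rewrite -(fmap0 RR RR); apply/Fexact; first by apply: rhomP.
    by rewrite /e_exact ker0 range_submodule_val.
  by rewrite -fmapM p_i fmap0.
(* [F] cannot tell [p] from [0], so [R -0-> R/D --> 0] is e-exact too. *)
have p_exact : e_exact p (0 : mor Q Q).
  rewrite /e_exact ker0; suff -> : range (p : RR -> Q) = setT.
    exact/essential_in_refl/submoduleT.
  apply/seteqP; split=> // q _; exists (repr (q : Quotient.quot _)) => //.
  exact: quotient_projK.
have zero_exact : e_exact (0 : mor RR Q) (0 : mor Q Q).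
  apply/Fexact; first exact: rhomP.
  by rewrite fmap0 -Fp0; apply/Fexact => //; apply: rhomP.
(* Essentiality of the zero image is tested against all of [R/D], which is nonzero because [p 1 = 0]
   would put 1 in [D]. *)
have [_ _ _ /(_ setT)] := zero_exact.
rewrite ker0 setIT; apply=> //; first exact: submoduleT.
- move=> Q0; apply/D1/(quotient_proj_eq0 sD).
  by suff : [set 0 : Q] (p 1) by []; rewrite -Q0.
- by apply/seteqP; split=> [_ [x _ <-]|_ ->] //; exists 0.
Qed.
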